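(* Let $\epsilon\in(0,1)$ and let $F=(f_n)_{n\ge1}$ be any sequence of positive integers for which $f_n=\sum_{i\le\epsilon n}f_i$ for all sufficiently large $n$. Then every $\epsilon$-complete sequence $A=(a_n)_{n\ge1}$ (listed in increasing order) satisfies $a_n=O(f_n)$, and there is an $\epsilon$-complete sequence $A=(a_n)_{n\ge1}$ with $a_n=\Theta(f_n)$.
   Context: For a sequence $A$ of positive integers, $\Sigma(A)$ is the set of integers representable as a sum of distinct terms of $A$; $A$ is complete if every sufficiently large positive integer lies in $\Sigma(A)$. A sequence $A$ of positive integers is $\epsilon$-complete if every subsequence $A'$ of $A$ with $|A'\cap[n]|\ge\epsilon|A\cap[n]|$ for all sufficiently large $n$ is complete. Here $[n]=\{1,\dots,n\}$. *)

(* Defs.v *)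
From Stdlib Require Import Reals.
From mathcomp Require Import all_boot.
Set Implicit Arguments. Unset Strict Implicit. Unset Printing Implicit Defensive.

(* A set of positive integers is a boolean predicate on nat (with 0 not in it). *)

Definition count_upto (A : pred nat) (n : nat) : nat := count A (iota 1 n).

Definition in_Sigma (A : pred nat) (m : nat) : Prop :=
  exists s : seq nat, [/\ uniq s, all A s & sumn s = m].

Definition complete (A : pred nat) : Prop :=
  exists N : nat, forall m : nat, (N <= m)%N -> in_Sigma A m.

Definition eps_complete (eps : R) (A : pred nat) : Prop :=
  forall A' : pred nat, (forall x, A' x -> A x) ->
    (exists N : nat, forall n : nat, (N <= n)%N ->
        Rle (Rmult eps (INR (count_upto A n))) (INR (count_upto A' n))) ->
    complete A'.

(* m is the n-th term a_n of A listed in increasing order (n >= 1) *)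
Definition nth_term (A : pred nat) (n m : nat) : Prop :=
  A m /\ count_upto A m = n.

Definition bigO_terms (A : pred nat) (f : nat -> nat) : Prop :=
  exists (C : R) (N : nat), Rlt 0 C /\
    forall n m, (N <= n)%N -> nth_term A n m -> Rle (INR m) (Rmult C (INR (f n))).

Definition Theta_terms (A : pred nat) (f : nat -> nat) : Prop :=
  exists (c C : R) (N : nat), Rlt 0 c /\ Rlt 0 C /\
    forall n m, (N <= n)%N -> nth_term A n m ->
      Rle (Rmult c (INR (f n))) (INR m) /\ Rle (INR m) (Rmult C (INR (f n))).

(* f_n = sum_{1 <= i <= eps n} f_i  (note eps n < n so i ranges within [n]) *)
Definition eps_recurrence (eps : R) (f : nat -> nat) (n : nat) : Prop :=
  f n = sumn [seq f i | i <- iota 1 n & if Rle_dec (INR i) (Rmult eps (INR n)) then true else false].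

(* Main.v *)
Require Import Defs.
From Stdlib Require Import ZArith Reals Lra Classical.
From mathcomp Require Import all_boot zify.
Set Implicit Arguments. Unset Strict Implicit. Unset Printing Implicit Defensive.
Delimit Scope R_scope with R.

(** Upper bound.  If for every [R] infinitely many [n] had
    [a_n > 1 + sum_{i <= eps n + R} a_i], then deleting the terms between indices
    [eps n + R] and [n] along a sparse sequence of such [n] would leave a subsequence of
    density [eps] that misses [a_n - 1] infinitely often.  Hence
    [a_n <= 1 + sum_{i <= eps n + R} a_i] eventually for some [R]; translating the index by a
    suitable constant removes [R], and comparison with the recurrence gives [a_n = O(f_n)].

    Construction.  Since [f_(eps n) / f_n = O(n^(-1/2))], the perturbation
    [(1 + n^(-1/4)) f_n] satisfies the recurrence as an inequality with room for dropping any
    fixed number [T] of the last summands.  Arrange values of that size in blocks of [l >= 2/eps]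
    terms, each an arithmetic progression of difference [M = l!] with terms 1 modulo [M].
    A subsequence of density [eps] contains two terms of the same block, at fixed positions,
    infinitely often: this yields infinitely many pairs with a common difference [q = d M],
    [d < l], and terms in one residue class prime to [q].  Boundedly many of these have subset
    sums filling an interval of any prescribed length, and if the pairs are taken far enough out,
    the slack lets the remaining terms extend the interval indefinitely. *)

(** * Transfer between natural and real inequalities *)

Lemma leqR m n : (m <= n)%N -> (INR m <= INR n)%R.
Proof. by move=> mn; apply: le_INR; lia. Qed.

Lemma leqRE m n : (INR m <= INR n)%R -> (m <= n)%N.
Proof. by move/INR_le; lia. Qed.

Lemma ltnRE m n : (INR m < INR n)%R -> (m < n)%N.
Proof. by move/INR_lt; lia. Qed.

Lemma nat_floor (x : R) : (0 <= x)%R ->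
  (INR (Z.to_nat (Int_part x)) <= x < INR (Z.to_nat (Int_part x)) + 1)%R.
Proof.
move=> x0; have [h1 h2] := base_Int_part x.
have z0 : (0 <= Int_part x)%Z.
  have : (IZR (-1) < IZR (Int_part x))%R by lra.
  move/lt_IZR; lia.
by rewrite INR_IZR_INZ Z2Nat.id //; lra.
Qed.

Lemma nat_above (x : R) : exists n : nat, (x <= INR n)%R.
Proof.
exists (Z.to_nat (up x)); have [h _] := archimed x.
case: (Z_le_gt_dec 0 (up x)) => h0.
  by rewrite INR_IZR_INZ Z2Nat.id //; lra.
have : (IZR (up x) < 0)%R by apply: IZR_lt; lia.
by have := pos_INR (Z.to_nat (up x)); lra.
Qed.

(** * Integer parts and subsets of an increasing sequence *)

Definition eps_floor (eps : R) (n : nat) : nat := Z.to_nat (Int_part (eps * INR n)).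

Section EpsFloor.
Variables (eps : R) (Heps : Rlt 0 eps /\ Rlt eps 1).
Local Notation fl := (eps_floor eps).

Lemma eps_floorP n : (INR (fl n) <= eps * INR n < INR (fl n) + 1)%R.
Proof. by apply: nat_floor; have := pos_INR n; nra. Qed.

Lemma eps_floor_geP i n : (INR i <= eps * INR n)%R -> (i <= fl n)%N.
Proof.
move=> h; have [_ h2] := eps_floorP n.
have : (INR i < INR (fl n).+1)%R by rewrite S_INR; lra.
by move/ltnRE.
Qed.

Lemma eps_floor_le n : (fl n <= n)%N.
Proof. by have [h _] := eps_floorP n; apply: leqRE; have := pos_INR n; nra. Qed.

Lemma eps_floor_lt n : (0 < n)%N -> (fl n < n)%N.
Proof.
move=> n0; have [h _] := eps_floorP n; apply: ltnRE.
have n0R : (0 < INR n)%R by apply: lt_0_INR; lia.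
by nra.
Qed.

Lemma eps_floor_mono m n : (m <= n)%N -> (fl m <= fl n)%N.
Proof.
move=> /leqR mn; apply: eps_floor_geP; have [h _] := eps_floorP m.
by nra.
Qed.

Lemma eps_floor_lb i n : (i <= fl n)%N -> (INR i <= eps * INR n)%R.
Proof. by move/leqR=> h; have [h2 _] := eps_floorP n; lra. Qed.

Lemma eps_floorS n : (fl n.+1 <= (fl n).+1)%N.
Proof.
have [h1 _] := eps_floorP n.+1; have [_ h2] := eps_floorP n.
suff : (INR (fl n.+1) < INR (fl n).+2)%R by move/ltnRE.
by rewrite !S_INR in h1 *; lra.
Qed.

Lemma eps_floor_unbounded k : exists N, forall n, (N <= n)%N -> (k <= fl n)%N.
Proof.
have [N hN] := nat_above (INR k / eps).
exists N => n /leqR Nn; apply: eps_floor_geP.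
have : (INR k / eps <= INR n)%R by lra.
move/(Rmult_le_compat_l eps); have -> : (eps * (INR k / eps) = INR k)%R by field; lra.
by apply; lra.
Qed.

Lemma eps_recurrenceE f n : eps_recurrence eps f n ->
  f n = \sum_(1 <= i < (fl n).+1) f i.
Proof.
rewrite /eps_recurrence => ->.
rewrite sumnE big_map /index_iota subSS subn0.
congr (bigop _ _ _); rewrite -[in iota 1 n](subnKC (eps_floor_le n)) iotaD filter_cat.
rewrite (_ : filter _ (iota 1 (fl n)) = iota 1 (fl n)); last first.
  apply/all_filterP/allP => i; rewrite mem_iota => hi.
  by case: Rle_dec => // -[]; apply: eps_floor_lb; lia.
rewrite (_ : filter _ _ = [::]) ?cats0 //.
apply/eqP; rewrite -[_ == _]negbK -has_filter; apply/hasPn => i.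
rewrite mem_iota => hi; case: Rle_dec => // h; have := eps_floor_geP h; lia.
Qed.

End EpsFloor.

Section Image.
Variables (a : nat -> nat).
Hypothesis (a_mono : forall i j, (i < j)%N -> (a i < a j)%N) (a0 : (0 < a 0)%N).

(** For increasing positive [a], [i < a i], so the search below [x] suffices. *)
Definition image_set (P : pred nat) : pred nat :=
  fun x => has (fun i => P i && (a i == x)) (iota 0 x).

Lemma increasing_gt i : (i < a i)%N.
Proof. by elim: i => // i IH; have := a_mono (ltnSn i); lia. Qed.

Lemma increasing_leE i j : (a i <= a j)%N = (i <= j)%N.
Proof.
case: (ltngtP i j) => [/a_mono|/a_mono|->]; lia.
Qed.

Lemma increasing_inj : injective a.
Proof. by move=> i j e; case: (ltngtP i j) => // /a_mono; rewrite e ltnn. Qed.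

Lemma image_setP (P : pred nat) x :
  reflect (exists2 i, P i & a i = x) (image_set P x).
Proof.
apply: (iffP hasP) => [[i _ /andP[Pi /eqP <-]]|[i Pi <-]]; first by exists i.
by exists i; rewrite ?Pi ?eqxx // mem_iota /= increasing_gt.
Qed.

Lemma count_image_set (P : pred nat) x k :
  (forall i, (a i <= x)%N = (i < k)%N) ->
  count_upto (image_set P) x = count P (iota 0 k).
Proof.
move=> hk; rewrite /count_upto -!size_filter -[RHS](size_map a); apply: perm_size.
apply: uniq_perm; first by rewrite filter_uniq ?iota_uniq.
  by rewrite (map_inj_uniq increasing_inj) filter_uniq ?iota_uniq.
move=> y; rewrite mem_filter mem_iota; apply/andP/mapP.
  case=> /image_setP[i Pi <-] /andP[_ hi]; exists i => //.
  by rewrite mem_filter Pi mem_iota -hk; lia.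
case=> i; rewrite mem_filter mem_iota add0n => /andP[Pi hi] ->; split.
  by apply/image_setP; exists i.
by have := increasing_gt i; have := hk i; lia.
Qed.

Lemma count_image_set_at (P : pred nat) n :
  count_upto (image_set P) (a n) = count P (iota 0 n.+1).
Proof. by apply: count_image_set => i; rewrite increasing_leE ltnS. Qed.

(** Turns a cutoff on values, at any [x], into a cutoff on indices. *)
Lemma image_set_level x : exists k, forall i, (a i <= x)%N = (i < k)%N.
Proof.
exists (count (fun i => a i <= x)%N (iota 0 x.+1)).
have ex : exists k, (x < a k)%N by exists x; apply: increasing_gt.
case: (ex_minnP ex) => k hk kmin.
have lev i : (a i <= x)%N = (i < k)%N.
  case: (leqP (a i) x) => h.
    by case: ltnP => // ki; move: ki; rewrite -increasing_leE; lia.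
  by have := kmin _ h; lia.
have kx : (k <= x.+1)%N by apply: kmin; have := increasing_gt x.+1; lia.
move=> i; rewrite (eq_count lev) -(subnKC kx) iotaD count_cat.
rewrite (_ : count _ (iota 0 k) = k); last first.
  rewrite -[RHS](size_iota 0 k); apply/eqP; rewrite -all_count.
  by apply/allP => j; rewrite mem_iota; lia.
rewrite (_ : count _ (iota (0 + k) _) = 0); last first.
  apply/eqP; rewrite -leqn0 leqNgt -has_count; apply/hasPn => j.
  by rewrite mem_iota; lia.
by rewrite addn0 lev.
Qed.

Lemma in_Sigma_image_set (P : pred nat) m :
  in_Sigma (image_set P) m <->
  exists s, [/\ uniq s, all P s & \sum_(i <- s) a i = m].
Proof.
split=> [[s [us /allP sP sm]]|[s [us sP sm]]]; last first.
  exists (map a s); split; first by rewrite (map_inj_uniq increasing_inj).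
    by rewrite all_map; apply/allP => i /(allP sP) Pi; apply/image_setP; exists i.
  by rewrite sumnE big_map.
have [t [tP ts]] : exists t, all P t /\ map a t = s.
  elim: s sP {us sm} => [|x s IH] h; first by exists [::].
  have [t [tP ts]] : exists t, all P t /\ map a t = s.
    by apply: IH => y ys; apply: h; rewrite inE ys orbT.
  have /image_setP[i Pi ai] := h x (mem_head _ _).
  by exists (i :: t); rewrite /= Pi tP ai ts.
exists t; split => //; first by rewrite -(map_inj_uniq increasing_inj) ts.
by rewrite -sm -ts sumnE big_map.
Qed.

(** Counting from 0, the selected index number [i] is at least [i], so its term is at least
    [a i]. *)
Lemma sum_first_le (P : pred nat) n y : (y <= count P (iota 0 n))%N ->
  (\sum_(0 <= i < y) a i <= \sum_(0 <= i < n | P i) a i)%N.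
Proof.
elim: n y => [|n IH] y; first by rewrite leqn0 => /eqP ->; rewrite !big_geq.
have -> : iota 0 n.+1 = rcons (iota 0 n) n by rewrite -addn1 iotaD cats1.
rewrite -cats1 count_cat /= addn0 [X in _ -> (_ <= X)%N]big_mkcond big_nat_recr //= -big_mkcond
  /=.
case: (P n); last by rewrite !addn0; apply: IH.
case: y => [|y]; first by rewrite big_geq.
rewrite addn1 ltnS big_nat_recr //= => hy; apply: leq_add; first exact: IH.
rewrite increasing_leE; apply: leq_trans hy _.
by rewrite -[leqRHS](size_iota 0); apply: count_size.
Qed.

End Image.

(** * The upper bound *)

Lemma sum_uniq_le (F : nat -> nat) (P : pred nat) s k :
  uniq s -> all P s -> all (fun i => i < k)%N s ->
  (\sum_(i <- s) F i <= \sum_(0 <= i < k | P i) F i)%N.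
Proof.
move=> us /allP sP /allP sk.
have -> : \sum_(i <- s) F i = \sum_(i <- iota 0 k | i \in s) F i.
  rewrite -[RHS]big_filter; apply/perm_big/uniq_perm => //.
    by rewrite filter_uniq ?iota_uniq.
  move=> i; rewrite mem_filter mem_iota /= add0n.
  by case: (boolP (i \in s)) => // /sk.
rewrite /index_iota subn0 [leqLHS]big_mkcond [leqRHS]big_mkcond /=.
by apply: leq_sum => i _; case: (boolP (i \in s)) => // /sP ->.
Qed.

Lemma complete_infinite A : complete A -> forall n, exists x, (n < x)%N && A x.
Proof.
(* The number exceeds the sum of all integers up to [n], so representing it takes a larger term. *)
case=> N hN n; have [s [us sA sm]] := hN (N + (\sum_(0 <= i < n.+1) i).+1)%N (leq_addr _ _).
case: (boolP (all (fun i => i < n.+1)%N s)) => [sn|/allPn[x xs]].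
  have h : (\sum_(i <- s) i <= \sum_(0 <= i < n.+1) i)%N.
    exact: (@sum_uniq_le id predT s n.+1 us (all_predT s) sn).
  by rewrite -sumnE sm in h; lia.
by rewrite -leqNgt => nx; exists x; rewrite nx (allP sA).
Qed.

Lemma enumeration A : ~~ A 0 -> (forall n, exists x, (n < x)%N && A x) ->
  exists a, [/\ forall i j, (i < j)%N -> (a i < a j)%N, (0 < a 0)%N &
    A =1 image_set a predT].
Proof.
move=> A0 inf; pose next n := ex_minn (inf n); pose a i := iter i.+1 next 0.
have next_gt n : (n < next n)%N by rewrite /next; case: ex_minnP => m /andP[].
have nextA n : A (next n) by rewrite /next; case: ex_minnP => m /andP[].
have next_min n x : (n < x)%N -> A x -> (next n <= x)%N.
  by move=> nx Ax; rewrite /next; case: ex_minnP => m _; apply; rewrite nx.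
have a0 : (0 < a 0)%N by apply: next_gt.
have aS i : a i.+1 = next (a i) by [].
have a_mono i j : (i < j)%N -> (a i < a j)%N.
  elim: j => // j IH; rewrite ltnS leq_eqVlt aS => /orP[/eqP -> //|/IH h].
  by apply: ltn_trans h _; apply: next_gt.
exists a; split => // x; apply/idP/(image_setP a_mono a0) => [Ax|[i _ <-]]; last exact: nextA.
have [k hk] := image_set_level a_mono a0 x.
have x0 : (0 < x)%N by case: (x) Ax A0 => // ->.
have k0 : (0 < k)%N by rewrite -hk; apply: next_min.
exists k.-1 => //; apply/eqP; rewrite eqn_leq hk prednK // leqnn /=.
rewrite leqNgt; apply/negP => lt; have := next_min _ _ lt Ax.
by rewrite -aS prednK // hk ltnn.
Qed.

Section Necessity.
Variables (eps : R) (Heps : Rlt 0 eps /\ Rlt eps 1).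
Local Notation fl := (eps_floor eps).
Variables (a : nat -> nat).
Hypothesis (a_mono : forall i j, (i < j)%N -> (a i < a j)%N) (a0 : (0 < a 0)%N).

(** If exactly [k] terms are at most [n], both counts up to [n] run over the first [k] indices. *)
Lemma eps_complete_image A (P : pred nat) : A =1 image_set a predT ->
  eps_complete eps A ->
  (exists N, forall k, (N <= k)%N -> (eps * INR k <= INR (count P (iota 0 k)))%R) ->
  complete (image_set a P).
Proof.
move=> Aa cA [N hN]; apply: cA.
  by move=> x /(image_setP a_mono a0)[i _ <-]; rewrite Aa; apply/(image_setP a_mono a0); exists i.
exists (a N) => n Nn; have [k hk] := image_set_level a_mono a0 n.
have -> : count_upto A n = k.
  rewrite /count_upto (eq_count Aa) -/(count_upto (image_set a predT) n).
  by rewrite (count_image_set a_mono a0 _ hk) count_predT size_iota.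
by rewrite (count_image_set a_mono a0 _ hk); apply: hN; rewrite hk in Nn; apply: ltnW.
Qed.

(** A representation of [a i - 1] has no room for a term of index [i] or more. *)
Lemma complete_image_bound (P : pred nat) : complete (image_set a P) ->
  exists N, forall i, (N <= i)%N -> (a i <= (\sum_(0 <= j < i | P j) a j).+1)%N.
Proof.
case=> N hN; exists N => i Ni; have ai := increasing_gt a_mono a0 i.
have /(in_Sigma_image_set a_mono a0)[s [us sP sm]] : in_Sigma (image_set a P) (a i).-1.
  by apply: hN; lia.
rewrite -[leqLHS](@prednK (a i)); last by lia.
rewrite ltnS -sm; apply: sum_uniq_le => //; apply/allP => j js.
rewrite ltnNge; apply/negP; rewrite -(increasing_leE a_mono a0) => ij.
have le1 : (a j <= (a i).-1)%N by rewrite -sm (big_rem j) //= leq_addr.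
by lia.
Qed.

(* For a sparse sequence [g] of violations, keep only the first [fl (g (t + 1)) + 1] indices of
   each interval from [g t] to [g (t + 1)]. *)
Lemma gap_bound A : A =1 image_set a predT -> eps_complete eps A ->
  exists R N, forall n, (N <= n)%N -> (a n <= (\sum_(0 <= j < fl n + R) a j).+1)%N.
Proof.
move=> Aa cA; apply: NNPP => neg.
(* A single [p] bounds the violation from below and sets the slack [p + 1], so both grow under
   iteration. *)
have bad p : exists n, (p < n)%N && ((\sum_(0 <= j < fl n + p.+1) a j).+1 < a n)%N.
  apply: NNPP => h; apply: neg; exists p.+1, p.+1 => n pn.
  by rewrite leqNgt; apply/negP => h2; apply: h; exists n; rewrite pn.
pose next p := ex_minn (bad p); pose g t := iter t next 0.
have nextP p : (p < next p)%N /\ ((\sum_(0 <= j < fl (next p) + p.+1) a j).+1 < a (next p))%N.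
  by rewrite /next; case: ex_minnP => m /andP[].
have gS t : g t.+1 = next (g t) by [].
have g_lt t : (g t < g t.+1)%N by rewrite gS; case: (nextP (g t)).
have g_le t u : (t <= u)%N -> (g t <= g u)%N.
  by elim: u => [|u IH];
    [rewrite leqn0 => /eqP -> | rewrite leq_eqVlt => /orP[/eqP -> //|/IH h];
    apply: leq_trans h (ltnW _)].
have g_ge t : (t <= g t)%N by elim: t => // t IH; apply: leq_ltn_trans IH _.
pose P j := ~~ has (fun t => (fl (g t.+1) + (g t).+1 <= j) && (j < g t.+1))%N (iota 0 j.+1).
have P_in t j : (g t <= j < g t.+1)%N -> P j = (j < fl (g t.+1) + (g t).+1)%N.
  move=> /andP[h1 h2]; rewrite /P ltnNge; congr negb; apply/hasP/idP => [[u _ /andP[h3 h4]]|h].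
    have [ut|tu] := leqP u t; last by have := g_le _ _ tu; lia.
    move: ut; rewrite leq_eqVlt => /orP[/eqP <- //|ut].
    by have := g_le _ _ ut; lia.
  by exists t; [rewrite mem_iota; have := g_ge t; lia | rewrite h h2].
have cntD u v : (u <= v)%N -> count P (iota 0 v) = (count P (iota 0 u) + count P (iota u (v -
  u)))%N.
  by move=> uv; rewrite -{1}(subnKC uv) iotaD count_cat.
have cnt_full t u : (g t <= u <= g t.+1)%N -> (u <= fl (g t.+1) + (g t).+1)%N ->
    count P (iota (g t) (u - g t)) = (u - g t)%N.
  move=> h1 h2; rewrite -[RHS](size_iota (g t)); apply/eqP; rewrite -all_count.
  by apply/allP => j; rewrite mem_iota => hj; rewrite (P_in t); lia.
(* Along the kept part every index counts; along the deleted part the count is at least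
   [fl (g t.+1) + 1], above [eps * g t.+1]. *)
have step t k : (eps * INR (g t) <= INR (count P (iota 0 (g t))))%R ->
    (g t <= k <= g t.+1)%N -> (eps * INR k <= INR (count P (iota 0 k)))%R.
  move=> IH /andP[h1 h2].
  have [hk|hk] := leqP k (fl (g t.+1) + (g t).+1).
    rewrite (cntD _ _ h1) cnt_full ?h1 // plus_INR.
    have -> : INR k = (INR (g t) + INR (k - g t))%R by rewrite -plus_INR; congr INR; lia.
    by have := pos_INR (k - g t); nra.
  have le1 : ((fl (g t.+1)).+1 <= count P (iota 0 k))%N.
    rewrite (cntD (fl (g t.+1) + (g t).+1)%N) ?(ltnW hk) //.
    rewrite (cntD (g t) (_ + _)%N); last by lia.
    by rewrite cnt_full; lia.
  have [_ fP] := eps_floorP Heps (g t.+1).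
  have := leqR le1; rewrite S_INR; have := leqR h2; nra.
have dens_g t : (eps * INR (g t) <= INR (count P (iota 0 (g t))))%R.
  elim: t => [|t IH]; first by rewrite /= Rmult_0_r; lra.
  by apply: step IH _; rewrite leqnn ltnW.
have dens k : (eps * INR k <= INR (count P (iota 0 k)))%R.
  have ex : exists t, (k < g t)%N by exists k.+1; apply: g_ge.
  case: (ex_minnP ex) => -[//|t] kt tmin; apply: (step t) => //.
  rewrite (ltnW kt) andbT leqNgt; apply/negP => /tmin; lia.
have /complete_image_bound[N hN] := eps_complete_image Aa cA (ex_intro _ 0 (fun k _ => dens k)).
have := hN (g N.+1) (leq_trans (leqnSn N) (g_ge _)).
have [_] := nextP (g N); rewrite -gS => lt /(leq_trans lt); rewrite !ltnS leqNgt => /negP[].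
(* All kept indices below [g N.+1] are below [m], so their sum is too small for the violation at
   [g N.+1]. *)
rewrite ltnS; set m := (fl _ + _)%N.
have -> : \sum_(0 <= j < g N.+1 | P j) a j = \sum_(j <- filter P (iota 0 (g N.+1))) a j.
  by rewrite big_filter /index_iota subn0.
apply: sum_uniq_le => //; first by rewrite filter_uniq ?iota_uniq.
  exact: all_predT.
apply/allP => j; rewrite mem_filter mem_iota => /andP[Pj hj].
have [gj|gj] := leqP (g N) j; last by rewrite /m; lia.
by rewrite -(P_in N) //; lia.
Qed.

End Necessity.

(* The constant [K] is absorbed because the claim [c n + K <= C * f n] leaves a surplus of
   [K] in each of the at least two summands of [f n]. *)
Lemma recurrence_domination (eps : R) (Heps : Rlt 0 eps /\ Rlt eps 1) (f c : nat -> nat) K :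
  (forall n, (1 <= n)%N -> (0 < f n)%N) ->
  (exists N, forall n, (N <= n)%N -> f n = \sum_(1 <= i < (eps_floor eps n).+1) f i) ->
  (exists N, forall n, (N <= n)%N -> (c n <= K + \sum_(1 <= i < (eps_floor eps n).+1) c i)%N) ->
  exists C, forall n, (1 <= n)%N -> (c n <= C * f n)%N.
Proof.
move=> fpos [N1 hf] [N2 hc]; have [N3 hN3] := eps_floor_unbounded Heps 2.
pose N := (N1 + N2 + N3)%N; pose C := (\sum_(0 <= i < N) (c i + K))%N.
suff h n : (1 <= n)%N -> (c n + K <= C * f n)%N.
  by exists C => n /h; lia.
elim/ltn_ind: n => n IH n1; have [Nn|nN] := leqP N n; last first.
  apply: (@leq_trans C); last by rewrite leq_pmulr ?fpos.
  by rewrite /C (big_cat_nat (n := n)) ?(ltnW nN) //= (big_ltn nN); lia.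
have le1 := hc n ltac:(lia); rewrite (hf n); last by lia.
have y2 := hN3 n ltac:(lia); have yn := eps_floor_lt Heps n1.
have : (\sum_(1 <= i < (eps_floor eps n).+1) (c i + K) <= C * \sum_(1 <= i < (eps_floor eps
  n).+1) f i)%N.
  rewrite big_distrr /= big_nat [leqRHS]big_nat; apply: leq_sum => i /andP[i1 i2].
  by apply: IH => //; lia.
by rewrite big_split /= sum_nat_const_nat; nia.
Qed.

(** [nth_term] numbers from 1 and [a] from 0, hence the predecessor. *)
Lemma nth_term_image a (a_mono : forall i j, (i < j)%N -> (a i < a j)%N)
  (a0 : (0 < a 0)%N) n m :
  nth_term (image_set a predT) n m -> (0 < n)%N /\ m = a n.-1.
Proof.
case=> /(image_setP a_mono a0)[i _ <-].
by rewrite (count_image_set_at a_mono a0) count_predT size_iota => <-.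
Qed.

Lemma eps_complete_bigO (eps : R) (Heps : Rlt 0 eps /\ Rlt eps 1) (f : nat -> nat) A :
  (forall n, (1 <= n)%N -> (0 < f n)%N) ->
  (exists N, forall n, (N <= n)%N -> f n = \sum_(1 <= i < (eps_floor eps n).+1) f i) ->
  ~~ A 0 -> eps_complete eps A -> bigO_terms A f.
Proof.
move=> fpos hf A0 cA.
have [a [a_mono a0 Aa]] : exists a, [/\ forall i j, (i < j)%N -> (a i < a j)%N, (0 < a 0)%N &
    A =1 image_set a predT].
  (* As [eps < 1], [A] is an admissible subsequence of itself, hence complete and infinite. *)
  apply: enumeration => //; apply/complete_infinite/cA => //; exists 0 => n _.
  by have := pos_INR (count_upto A n); nra.
have [r [N hN]] := gap_bound Heps a_mono a0 Aa cA.
(* Translating by this [p] raises the floor by at most [p - r], which cancels the [r] extra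
   summands. *)
have [p hp] := nat_above (INR r.+1 / (1 - eps)).
have {}hp : (INR r.+1 <= (1 - eps) * INR p)%R.
  have -> : INR r.+1 = ((1 - eps) * (INR r.+1 / (1 - eps)))%R by field; lra.
  by apply: Rmult_le_compat_l => //; lra.
have shift n : (eps_floor eps (n + p) + r <= eps_floor eps n + p)%N.
  have [h1 _] := eps_floorP Heps (n + p); have [_ h2] := eps_floorP Heps n.
  suff /ltnRE : (INR (eps_floor eps (n + p) + r) < INR (eps_floor eps n + p).+1)%R by [].
  rewrite S_INR in hp; rewrite plus_INR in h1.
  by rewrite S_INR !plus_INR; lra.
pose c n := a (n + p).
have [C hC] : exists C, forall n, (1 <= n)%N -> (c n <= C * f n)%N.
  (* The translated sum begins at index [p + 1]; [K] holds the terms up to index [p] and the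
     additive 1. *)
  apply: (recurrence_domination (K := (\sum_(0 <= j < p.+1) a j).+1) Heps fpos hf).
  exists N => n Nn; apply: leq_trans (hN (n + p) (leq_trans Nn (leq_addr _ _))) _.
  rewrite addSn ltnS.
  have -> : \sum_(1 <= i < (eps_floor eps n).+1) c i =
            \sum_(p.+1 <= i < p.+1 + eps_floor eps n) a i.
    rewrite (addnC p.+1) -{1}(add0n p.+1) big_addn addnK big_add1 /=.
    by apply: eq_bigr => i _; rewrite /c addnS addSn.
  rewrite -big_cat_nat ?leq_addr //.
  rewrite [leqRHS](big_cat_nat (n := eps_floor eps (n + p) + r)) ?leq_addr //=.
  by have := shift n; lia.
exists (INR C + 1)%R, 1; split; first by have := pos_INR C; lra.
move=> n m n1 [Am cm].
have [_ ->] : (0 < n)%N /\ m = a n.-1.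
  apply: (nth_term_image a_mono a0); split; first by rewrite -Aa.
  by rewrite -cm /count_upto (eq_count Aa).
have /leqR : (a n.-1 <= C * f n)%N.
  by apply: leq_trans (hC n n1); rewrite (increasing_leE a_mono a0); lia.
by rewrite mult_INR; have := pos_INR (f n); lra.
Qed.

(** * Growth of solutions of the recurrence *)

Lemma sum_ge_const (F : nat -> nat) c u v : (forall i, (u <= i < v)%N -> (c <= F i)%N) ->
  ((v - u) * c <= \sum_(u <= i < v) F i)%N.
Proof.
by move=> h; rewrite -sum_nat_const_nat big_nat [leqRHS]big_nat; apply: leq_sum.
Qed.

Section Growth.
Variables (eps : R) (Heps : Rlt 0 eps /\ Rlt eps 1).
Local Notation fl := (eps_floor eps).
Variables (f : nat -> nat) (N0 : nat).
Hypothesis fpos : forall n, (1 <= n)%N -> (0 < f n)%N.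
Hypothesis f_rec : forall n, (N0 <= n)%N -> f n = \sum_(1 <= i < (fl n).+1) f i.

Lemma rec_mono m n : (N0 <= m)%N -> (m <= n)%N -> (f m <= f n)%N.
Proof.
move=> Nm mn; rewrite (f_rec Nm) (f_rec (leq_trans Nm mn)).
have flmn := eps_floor_mono Heps mn.
by rewrite [leqRHS](big_cat_nat (n := (fl m).+1)) //= leq_addr.
Qed.

Lemma rec_step n : (N0 <= n)%N -> (f n.+1 <= f n + f (fl n.+1))%N.
Proof.
move=> Nn; rewrite (f_rec Nn) f_rec; last by lia.
have := eps_floorS Heps n; rewrite leq_eqVlt => /orP[/eqP ->|h].
  by rewrite big_nat_recr.
have -> : fl n.+1 = fl n by have := eps_floor_mono Heps (leqnSn n); lia.
exact: leq_addr.
Qed.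

Lemma rec_double n : (N0 <= n)%N -> (N0 <= fl n.+1)%N -> (f n.+1 <= 2 * f n)%N.
Proof.
move=> Nn Nfl; apply: leq_trans (rec_step Nn) _.
rewrite mulSn mul1n leq_add2l; apply: rec_mono => //.
by have := eps_floor_lt Heps (ltn0Sn n); lia.
Qed.

(** Each of the [t] uses of [rec_step] adds a value of [f] at an index at most [fl n]. *)
Lemma rec_back n t : (N0 + t <= n)%N -> (N0 <= fl (n - t))%N ->
  (f n <= f (n - t) + t * f (fl n))%N.
Proof.
elim: t => [|t IH] h1 h2; first by rewrite subn0 mul0n addn0.
have e : (n - t = (n - t.+1).+1)%N by lia.
have mono1 : (fl (n - t.+1) <= fl (n - t))%N by apply: eps_floor_mono => //; lia.
have mono2 : (fl (n - t) <= fl n)%N by apply: eps_floor_mono => //; lia.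
have le1 := IH ltac:(lia) ltac:(lia).
have := @rec_step (n - t.+1) ltac:(lia); rewrite -e => le2.
have le3 : (f (fl (n - t)) <= f (fl n))%N by apply: rec_mono => //; lia.
by rewrite mulSn; lia.
Qed.

(* [f n >= (Y - Z) f Z] with [Y = fl n], [Z = fl Y], so one of the ratios [f n / f Y],
   [f Y / f Z] is at least [w]; in the second case [f] varies slowly below [Y]. *)
Lemma rec_ratio n w : (0 < n)%N -> (w * w <= fl n - fl (fl n))%N -> (N0 <= fl (fl n - w))%N ->
  (w * f (fl n) <= 4 * f n)%N.
Proof.
move=> n0 hw hN; have [-> //|w0] := posnP w; set Y := fl n in hw hN *; set Z := fl Y in hw *.
have Yn : (Y < n)%N by apply: eps_floor_lt.
have := eps_floor_le Heps (Y - w); have : (fl (Y - w) <= Z)%N.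
  by apply: eps_floor_mono => //; lia.
move=> ZN NY.
have fn : f n = \sum_(1 <= i < Y.+1) f i by apply: f_rec; lia.
have ZY : (Z <= Y)%N by apply: eps_floor_le.
have fnZ : ((Y - Z) * f Z <= f n)%N.
  rewrite fn (big_cat_nat (n := Z.+1)) //=; apply: leq_trans (leq_addl _ _).
  rewrite -subSS; apply: sum_ge_const => i /andP[i1 i2]; apply: rec_mono; lia.
(* In the other case [w * w * f Z <= f n < w * f Y], so [w * f Z] is below [f Y]. *)
have [|small] := leqP (w * f Y) (f n); first by lia.
have wZ : (w * f Z <= f Y)%N by nia.
have wY : (w <= Y)%N by nia.
suff : (w./2.+1 * (f Y) <= 2 * f n)%N by nia.
(* Going back at most [w / 2] steps from [Y] loses at most [(w / 2) * f Z], which is at most half of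
   [f Y]. *)
have half i : (Y - w./2 <= i < Y.+1)%N -> (f Y <= 2 * f i)%N.
  move=> hi; have le1 := @rec_back Y (Y - i).
  have h2 : (fl (Y - w) <= fl (Y - (Y - i)))%N by apply: eps_floor_mono => //; lia.
  have := le1 ltac:(lia) ltac:(lia); rewrite subKn; last by lia.
  rewrite -/Z; nia.
rewrite fn (big_cat_nat (n := Y - w./2)) //=; [|lia..].
rewrite mulnDr; apply: leq_trans (leq_addl _ _).
rewrite big_distrr /=.
have -> : w./2.+1 = (Y.+1 - (Y - w./2))%N by lia.
exact: sum_ge_const.
Qed.
End Growth.

(** * A majorant with slack *)

(* The truncated subtraction only matters for small [n]. *)
Definition slack_sums (eps : R) (b : nat -> nat) : Prop :=
  forall T, exists N, forall n, (N <= n)%N ->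
    (b n <= \sum_(0 <= i < eps_floor eps n - T) b i)%N.

Lemma sum_widen (F : nat -> nat) m n : (m <= n)%N ->
  (\sum_(0 <= i < m) F i <= \sum_(0 <= i < n) F i)%N.
Proof. by move=> mn; rewrite [leqRHS](big_cat_nat (n := m)) //= leq_addr. Qed.

Lemma sum_scaleR (k : R) (F G : nat -> nat) u v :
  (forall i, (u <= i < v)%N -> (k * INR (F i) <= INR (G i))%R) ->
  (k * INR (\sum_(u <= i < v) F i) <= INR (\sum_(u <= i < v) G i))%R.
Proof.
elim: v => [|v IH] h; first by rewrite !big_geq //= Rmult_0_r; lra.
have [uv|vu] := leqP u v; last by rewrite !big_geq //= Rmult_0_r; lra.
rewrite !big_nat_recr //= !plus_INR.
have := IH (fun i hi => h i ltac:(lia)); have := h v ltac:(lia); lra.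
Qed.

Lemma leq_bigmax_ord (b : nat -> nat) n i : (i <= n)%N -> (b i <= \max_(j < n.+1) b j)%N.
Proof.
by rewrite -ltnS => lt_in; apply: (leq_bigmax (F := fun j : 'I_n.+1 => b j) (Ordinal lt_in)).
Qed.

Section Slack.
Variables (eps : R) (Heps : Rlt 0 eps /\ Rlt eps 1).
Local Notation fl := (eps_floor eps).

Lemma slack_sumsD b c : slack_sums eps b -> slack_sums eps c ->
  slack_sums eps (fun n => b n + c n)%N.
Proof.
move=> hb hc T; have [N1 h1] := hb T; have [N2 h2] := hc T.
exists (N1 + N2)%N => n hn; rewrite big_split /=.
by apply: leq_add; [apply: h1 | apply: h2]; lia.
Qed.

Lemma linear_le_floor : exists C N, forall n, (N <= n)%N -> (n <= C * fl n)%N.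
Proof.
(* The 2 absorbs rounding: [eps * n < fl n + 1 <= 2 * fl n] once [fl n >= 1]. *)
have [C hC] := nat_above (2 / eps); have [N hN] := eps_floor_unbounded Heps 1.
exists C, N => n /hN fl1; apply: leqRE; rewrite mult_INR.
have [_ h1] := eps_floorP Heps n; have := leqR fl1; rewrite [INR 1]/= => h2.
have e : (eps * (2 / eps) = 2)%R by field; lra.
have h3 : (2 <= eps * INR C)%R by rewrite -e; apply: Rmult_le_compat_l; lra.
apply: (Rmult_le_reg_l eps); first lra.
have := pos_INR C; nra.
Qed.

Lemma slack_sums_id : slack_sums eps id.
Proof.
move=> T; have [C [N hN]] := linear_le_floor.
have [N' hN'] := eps_floor_unbounded Heps (2 * (T + 2 * C))%N.
exists (N + N')%N => n hn.
have h1 := hN n ltac:(lia); have h2 := hN' n ltac:(lia).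
(* At least half of the [fl n] indices remain, each contributing at least [2 * C]; the total is at
   least [C * fl n]. *)
apply: leq_trans (_ : (fl n - T - 2 * C) * (2 * C) <= _)%N; first by nia.
rewrite (big_cat_nat (n := 2 * C)) //=; last by lia.
apply: leq_trans (leq_addl _ _).
by apply: sum_ge_const => i /andP[].
Qed.

(** For large [j <= n] the hypothesis at [j] bounds [b j], as the floor is monotone; for small [j] a
    constant does, which enough positive terms outweigh. *)
Lemma slack_sums_max b : (forall n, 0 < b n)%N ->
  (forall T, exists N, forall n, (N <= n)%N ->
     (b n <= \sum_(0 <= i < fl n - T) \max_(j < i.+1) b j)%N) ->
  slack_sums eps (fun n => \max_(j < n.+1) b j).
Proof.
move=> bpos hb T; have [N1 h1] := hb T.
have max_ge n i : (i <= n)%N -> (b i <= \max_(j < n.+1) b j)%N.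
  exact: leq_bigmax_ord.
pose c := \max_(j < N1.+1) b j.
have [N2 h2] := eps_floor_unbounded Heps (T + c)%N.
exists N2 => n hn; apply/bigmax_leqP => /= j _.
have [Nj|jN] := leqP N1 j.
  apply: leq_trans (h1 j Nj) _; apply: sum_widen; apply: leq_sub2r.
  by apply: eps_floor_mono => //; have := ltn_ord j; lia.
apply: leq_trans (max_ge N1 _ (ltnW jN)) _; rewrite -/c.
have le1 := h2 n hn.
apply: leq_trans (_ : (fl n - T - 0) * 1 <= _)%N; first by lia.
apply: sum_ge_const => i _; apply: leq_trans (bpos 0) _; exact: max_ge.
Qed.

End Slack.

Section Majorant.
Variables (eps : R) (Heps : Rlt 0 eps /\ Rlt eps 1).
Local Notation fl := (eps_floor eps).
Variables (f : nat -> nat) (N0 : nat).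
Hypothesis fpos : forall n, (1 <= n)%N -> (0 < f n)%N.
Hypothesis f_rec : forall n, (N0 <= n)%N -> f n = \sum_(1 <= i < (fl n).+1) f i.

Definition root4 (n : nat) : R := sqrt (sqrt (INR n)).

Lemma root4_pos n : (0 < n)%N -> (1 <= root4 n)%R.
Proof.
move=> n0; rewrite /root4 -{1}sqrt_1 -{1}sqrt_1.
by do 2 apply: sqrt_le_1_alt; apply: (@leqR 1).
Qed.

Lemma root4_mono m n : (m <= n)%N -> (root4 m <= root4 n)%R.
Proof. by move=> mn; do 2 apply: sqrt_le_1_alt; apply: leqR. Qed.

Lemma root4_unbounded (x : R) : exists N, forall n, (N <= n)%N -> (x <= root4 n)%R.
Proof.
have [k hk] := nat_above x; exists ((k * k) * (k * k))%N => n hn.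
apply: Rle_trans hk _; have <- : root4 ((k * k) * (k * k)) = INR k.
  by rewrite /root4 mult_INR sqrt_square ?mult_INR ?sqrt_square //; try apply: pos_INR;
    have := pos_INR k; nra.
exact: root4_mono.
Qed.

Lemma root4_sqr n : (root4 n * root4 n = sqrt (INR n))%R.
Proof. by rewrite /root4 sqrt_def //; apply: sqrt_pos. Qed.

Lemma root4_floor n : (root4 (fl n) <= sqrt (sqrt eps) * root4 n)%R.
Proof.
rewrite /root4 -sqrt_mult ?sqrt_pos //; try exact: sqrt_pos.
rewrite -sqrt_mult; [|lra|exact: pos_INR].
by do 2 apply: sqrt_le_1_alt; case: (eps_floorP Heps n).
Qed.

(** [rec_ratio] with [w] of order [sqrt n] makes [f (fl n) / f n] of order at most [n^(-1/2)],
    negligible against [n^(-1/4)]. *)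
Lemma rec_ratio_unbounded (x : R) : exists N, forall n, (N <= n)%N ->
  (x * INR (f (fl n)) <= / root4 n * INR (f n))%R.
Proof.
(* With [Y = fl n], [c^2 * n = (1 - eps) * eps * n / 2 <= (1 - eps) * Y <= Y - fl Y] for large [n],
   as [rec_ratio] demands of [w * w]. *)
pose c := sqrt ((1 - eps) * eps / 2).
have c0 : (0 < c)%R by apply: sqrt_lt_R0; nra.
have cc : (c * c = (1 - eps) * eps / 2)%R by apply: sqrt_def; nra.
have [N1 h1] := root4_unbounded ((4 * Rabs x + 1) / c).
have [N2 h2] := eps_floor_unbounded Heps N0.
(* From [Y >= 4] and [w * w <= Y] follows [w <= Y / 2], hence [Y - w >= N2]. *)
have [N3 h3] := eps_floor_unbounded Heps (2 * N2 + 4)%N.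
exists (N1 + N3 + 1)%N => n hn; have := h1 n ltac:(lia); have := h3 n ltac:(lia).
have s1 := root4_pos (n := n) ltac:(lia); have ss := root4_sqr n.
set s := root4 n in s1 ss *; set Y := fl n => hY hs.
pose w := Z.to_nat (Int_part (c * sqrt (INR n))).
have [w1 w2] : (INR w <= c * sqrt (INR n) < INR w + 1)%R.
  by apply: nat_floor; have := sqrt_pos (INR n); nra.
have [y1 y2] := eps_floorP Heps n; rewrite -/Y in y1 y2.
have [z1 z2] := eps_floorP Heps Y.
have Y4 : (4 <= INR Y)%R by rewrite (_ : 4%R = INR 4) ?INR_IZR_INZ //; apply: IZR_le; lia.
have ZY := eps_floor_le Heps Y.
have sn : (sqrt (INR n) * sqrt (INR n) = INR n)%R by apply: sqrt_def; apply: pos_INR.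
have hw : (w * w <= Y - fl Y)%N.
  apply: leqRE; rewrite mult_INR minus_INR; last by lia.
  have := pos_INR w; have := sqrt_pos (INR n) => p1 p2.
  have : (INR w * INR w <= (c * sqrt (INR n)) * (c * sqrt (INR n)))%R.
    by apply: Rmult_le_compat.
  have -> : ((c * sqrt (INR n)) * (c * sqrt (INR n)) = (1 - eps) * (eps * INR n / 2))%R.
    by rewrite -[in RHS]sn -[in LHS]Rmult_assoc; nra.
  have : ((1 - eps) * (eps * INR n / 2) <= (1 - eps) * INR Y)%R by apply: Rmult_le_compat_l; lra.
  lra.
have le1 : (w * f Y <= 4 * f n)%N.
  by apply: (rec_ratio Heps f_rec) => //; [lia | rewrite -/Y; apply: h2; nia].
have := leqR le1; rewrite !mult_INR -/Y [INR 4]INR_IZR_INZ /= => le2.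
have sx : (4 * Rabs x + 1 <= c * s)%R.
  have -> : (4 * Rabs x + 1 = c * ((4 * Rabs x + 1) / c))%R by field; lra.
  by apply: Rmult_le_compat_l; lra.
have wx : (4 * x * s <= INR w)%R.
  have xx := Rle_abs x; have : (4 * x * s <= 4 * Rabs x * s)%R by nra.
  have : ((4 * Rabs x + 1) * s <= c * s * s)%R by apply: Rmult_le_compat_r; lra.
  rewrite Rmult_assoc ss; lra.
apply: (Rmult_le_reg_l s); first lra.
have -> : (s * (/ s * INR (f n)) = INR (f n))%R by field; lra.
have := pos_INR (f Y); nra.
Qed.

(** The successor rounds up at a cost of at most 1 and keeps every value positive. *)
Definition majorant (n : nat) : nat :=
  (Z.to_nat (Int_part ((1 + / root4 n) * INR (f n)))).+1.

Lemma majorantP n : (0 < n)%N ->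
  ((1 + / root4 n) * INR (f n) <= INR (majorant n) <= (1 + / root4 n) * INR (f n) + 1)%R.
Proof.
move=> n0; rewrite S_INR; have s1 := root4_pos n0.
have s2 : (0 < / root4 n)%R by apply: Rinv_0_lt_compat; lra.
have : (0 <= (1 + / root4 n) * INR (f n))%R by have := pos_INR (f n); nra.
by move/nat_floor; lra.
Qed.

Lemma majorant_le n : (0 < n)%N -> (f n <= majorant n <= 3 * f n)%N.
Proof.
move=> n0; have [h1 h2] := majorantP n0; have s1 := root4_pos n0.
have [s2 s3] : (0 < / root4 n <= 1)%R.
  split; first by apply: Rinv_0_lt_compat; lra.
  by rewrite -Rinv_1; apply: Rinv_le_contravar; lra.
have f1 : (1 <= INR (f n))%R by apply: (@leqR 1); apply: fpos.
have p1 : (0 <= / root4 n * INR (f n))%R by apply: Rmult_le_pos; lra.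
have p2 : (/ root4 n * INR (f n) <= 1 * INR (f n))%R by apply: Rmult_le_compat_r; lra.
apply/andP; split; apply: leqRE; first by lra.
have e3 : INR 3 = 3%R by rewrite INR_IZR_INZ.
by rewrite mult_INR e3; lra.
Qed.

(** Indices up to [Y = fl n] carry at least the factor [1 + 1 / root4 Y], and
    [root4 Y <= eps^(1/4) * root4 n]. The surplus over [1 + 1 / root4 n] is worth a multiple of
    [f n / root4 n], more than any fixed multiple of [f Y]. *)
Lemma majorant_slack T : exists N, forall n, (N <= n)%N ->
  (majorant n <= \sum_(1 <= i < fl n - T) majorant i)%N.
Proof.
pose k := sqrt (sqrt eps).
have k0 : (0 < k)%R by do 2 apply: sqrt_lt_R0; lra.
have k1 : (k < 1)%R.
  have sqrt_lt1 x : (0 <= x < 1)%R -> (sqrt x < 1)%R.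
    by move=> hx; rewrite -sqrt_1; apply: sqrt_lt_1_alt.
  by apply: (sqrt_lt1); split; [exact: sqrt_pos | apply: sqrt_lt1; lra].
(* Each of the [T + 1] dropped summands costs at most [2 * f Y], and rounding at most one more
   [f Y]. *)
have [N1 h1] := rec_ratio_unbounded (INR (2 * T + 3) / (/ k - 1)).
have [N2 h2] := eps_floor_unbounded Heps (N0 + T + 2)%N.
exists (N0 + N1 + N2 + 1)%N => n hn; have := h1 n ltac:(lia); have := h2 n ltac:(lia).
have n0 : (0 < n)%N by lia.
have := root4_floor n; rewrite -/k; set Y := fl n => sY hY hr.
have Y0 : (0 < Y)%N by lia.
have fsum : (f n <= \sum_(1 <= i < Y - T) f i + T.+1 * f Y)%N.
  rewrite f_rec -/Y; last by lia.
  rewrite (big_cat_nat (n := Y - T)) //=; [|lia..].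
  rewrite leq_add2l big_nat.
  apply: leq_trans (_ : \sum_(Y - T <= i < Y.+1) f Y <= _)%N; last first.
    by rewrite sum_nat_const_nat; apply: leq_mul => //; lia.
  rewrite [leqRHS]big_nat; apply: leq_sum => i /andP[i1 i2]; apply: (rec_mono Heps f_rec); lia.
have := leqR fsum; rewrite plus_INR mult_INR => fsumR.
have s1 := root4_pos n0; have sY1 := root4_pos Y0.
have i1 : (0 < / root4 Y <= 1)%R.
  split; first by apply: Rinv_0_lt_compat; lra.
  by rewrite -Rinv_1; apply: Rinv_le_contravar; lra.
have i2 : (/ k * / root4 n <= / root4 Y)%R.
  by rewrite -Rinv_mult; apply: Rinv_le_contravar; lra.
have i3 : (0 < / root4 n)%R by apply: Rinv_0_lt_compat; lra.
have ik : (0 < / k - 1)%R.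
  have : (/ 1 < / k)%R by apply: Rinv_lt_contravar; lra.
  by rewrite Rinv_1; lra.
have main : ((1 + / root4 Y) * INR (\sum_(1 <= i < Y - T) f i) <=
             INR (\sum_(1 <= i < Y - T) majorant i))%R.
  apply: sum_scaleR => i hi; have i0 : (0 < i)%N by lia.
  have [h _] := majorantP i0; apply: Rle_trans h.
  apply: Rmult_le_compat_r; first exact: pos_INR.
  apply: Rplus_le_compat_l; apply: Rinv_le_contravar.
    by have := root4_pos i0; lra.
  by apply: root4_mono; lia.
apply: leqRE; have [_ hm] := majorantP n0.
have fY : (1 <= INR (f Y))%R by apply: (@leqR 1); apply: fpos.
have gain : (INR (2 * T + 3) * INR (f Y) <= (/ k - 1) * (/ root4 n * INR (f n)))%R.
  have -> : (INR (2 * T + 3) * INR (f Y) = (/ k - 1) * (INR (2 * T + 3) / (/ k - 1) * INR (f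
    Y)))%R.
    by field; split; lra.
  by apply: Rmult_le_compat_l; lra.
have gain2 : (INR (2 * T + 3) * INR (f Y) <= (/ root4 Y - / root4 n) * INR (f n))%R.
  apply: Rle_trans gain _; rewrite -Rmult_assoc; apply: Rmult_le_compat_r; [exact: pos_INR|lra].
rewrite plus_INR mult_INR in gain2; rewrite S_INR in fsumR.
have e2 : (INR 2 = 2)%R by [].
have e3 : (INR 3 = 3)%R by rewrite INR_IZR_INZ.
rewrite e2 e3 in gain2; have TR := pos_INR T.
have : ((1 + / root4 Y) * (INR (f n) - (INR T + 1) * INR (f Y)) <=
   (1 + / root4 Y) * INR (\sum_(1 <= i < Y - T) f i))%R.
  by apply: Rmult_le_compat_l; lra.
have : (/ root4 Y * ((INR T + 1) * INR (f Y)) <= 1 * ((INR T + 1) * INR (f Y)))%R.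
  by apply: Rmult_le_compat_r; nra.
nra.
Qed.

(** The running maximum makes [majorant] monotone and adding [n] makes it strictly so; both keep the
    slack and the order of magnitude. *)
Lemma slack_majorant : exists B, [/\ forall i j, (i < j)%N -> (B i < B j)%N,
  slack_sums eps B & exists C N, forall n, (N <= n)%N -> (f n <= B n <= C * f n)%N].
Proof.
pose M n := \max_(j < n.+1) majorant j.
have max_ge n i : (i <= n)%N -> (majorant i <= M n)%N.
  exact: leq_bigmax_ord.
exists (fun n => n + M n)%N; split.
- move=> i j ij; have : (M i <= M j)%N by apply/bigmax_leqP => k _; apply: max_ge;
  have := ltn_ord k; lia.
  by lia.
- apply: (slack_sumsD (slack_sums_id Heps)); apply: (slack_sums_max Heps) => // T.
  have [N hN] := majorant_slack T; exists N => n hn; apply: leq_trans (hN n hn) _.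
  have [t0|t0] := leqP 1 (fl n - T); last by rewrite big_geq // ltnW.
  rewrite [leqRHS](big_cat_nat (n := 1)) //=; apply: leq_trans (leq_addl _ _).
  by apply: leq_sum => i _; apply: max_ge.
have [C1 [N1 h1]] := linear_le_floor Heps.
(* [C1] serves the summand [n], since [f n >= fl n]; [M N0] and 3 serve the maximum over indices up
   to [N0] and beyond. *)
exists (C1 + M N0 + 3)%N, (N0 + N1 + 1)%N => n hn.
have n0 : (0 < n)%N by lia.
have := majorant_le n0; have := max_ge n n (leqnn n) => m1 /andP[m2 m3].
have nf : (n <= C1 * f n)%N.
  apply: leq_trans (h1 n ltac:(lia)) _; rewrite leq_mul2l; apply/orP; right.
  rewrite f_rec; last by lia.
  rewrite -[leqLHS]muln1 -[X in (X * _)%N]subn0 -subSS; apply: sum_ge_const => i /andP[i1 _].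
  exact: fpos.
have fn := fpos n0.
have Mf : (M n <= (M N0 + 3) * f n)%N.
  apply/bigmax_leqP => j _; have jn := ltn_ord j.
  have [Nj|jN] := leqP (j : nat) N0.
    by have := max_ge _ _ Nj; nia.
  have /majorant_le /andP[_ h] : (0 < (j : nat))%N by lia.
  by have := @rec_mono _ Heps _ _ f_rec j n ltac:(lia) ltac:(lia); nia.
by rewrite !mulnDl in Mf *; lia.
Qed.

End Majorant.

(** * The block sequence *)

Lemma residue_multiple q r m : (0 < q)%N -> (0 < r)%N -> coprime r q ->
  exists2 u, (u < q)%N & u * r = m %[mod q].
Proof.
move=> q0 r0 /(coprimeP _ r0)[[u v] /= uv].
exists ((m * u) %% q); first by rewrite ltn_mod.
have ur : (u * r = v * q + 1)%N by lia.
by rewrite modnMml -mulnA ur mulnDr muln1 mulnA modnMDl.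
Qed.

Lemma eventually_uniform (Q : nat -> nat -> Prop) l :
  (forall x, (x < l)%N -> exists n, forall j, (n <= j)%N -> Q x j) ->
  exists n, forall x j, (x < l)%N -> (n <= j)%N -> Q x j.
Proof.
elim: l => [|l IH] h; first by exists 0.
have [n1 h1] := IH (fun x hx => h x (ltnW hx)); have [n2 h2] := h l (ltnSn l).
exists (n1 + n2)%N => x j; rewrite ltnS leq_eqVlt => /orP[/eqP ->|xl] hj.
  by apply: h2; lia.
by apply: h1 => //; lia.
Qed.

Lemma infinite_select (J : pred nat) : (forall n, exists2 j, (n <= j)%N & J j) ->
  forall k n, exists s, [/\ size s = k, uniq s & all (fun j => (n <= j)%N && J j) s].
Proof.
move=> inf; elim=> [|k IH] n; first by exists [::].
have [j nj Jj] := inf n; have [s [sk us /allP sP]] := IH j.+1.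
exists (j :: s); split; rewrite /= ?sk ?us ?nj ?Jj ?andbT //=.
  by apply/negP => /sP; lia.
by apply/allP => i /sP; lia.
Qed.

Lemma count_remove (P : pred nat) (B : seq nat) n :
  (count P (iota 0 n) <= count (fun i => P i && (i \notin B)) (iota 0 n) + count (fun i =>
    i < n)%N B)%N.
Proof.
apply: (@leq_trans (count (fun i => P i && (i \notin B)) (iota 0 n) + count (mem B) (iota 0 n))).
  rewrite -count_predUI; apply: leq_trans (leq_addr _ _).
  by apply: sub_count => i /= ->; rewrite /= orbC orbN.
rewrite leq_add2l -!size_filter; apply: uniq_leq_size; first by rewrite filter_uniq ?iota_uniq.
by move=> i; rewrite !mem_filter mem_iota add0n /= => /andP[-> ->].
Qed.

(* Once an interval of length [L] is available, adjoining the remaining terms one at a time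
   keeps the set of sums an interval. *)
Lemma cascade (a : nat -> nat) (D : pred nat) (B : seq nat) X L :
  (forall i, D i -> i \notin B) ->
  (forall t, (t < L)%N -> exists s, [/\ uniq s, {subset s <= B} &
    \sum_(i <- s) a i = (X + t)%N]) ->
  (forall n, D n -> (a n <= L + \sum_(0 <= i < n | D i) a i)%N) ->
  forall n t, (t < L + \sum_(0 <= i < n | D i) a i)%N ->
  exists s, [/\ uniq s, all (fun i =>
    (i \in B) || (D i && (i < n)%N)) s & \sum_(i <- s) a i = (X + t)%N].
Proof.
move=> DB base step; elim=> [|n IH] t.
  rewrite big_geq // addn0 => /base[s [us sB ss]]; exists s; split => //.
  by apply/allP => i /sB ->.
have weak s : all (fun i => (i \in B) || (D i && (i < n)%N)) s ->
    all (fun i => (i \in B) || (D i && (i < n.+1)%N)) s.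
  apply: sub_all => i /orP[->//|/andP[-> h]]; by rewrite ltnW ?orbT.
rewrite big_mkcond big_nat_recr //= -big_mkcond /=.
case: (boolP (D n)) => [Dn|_]; last first.
  by rewrite addn0 => /IH[s [us /weak sB ss]]; exists s.
move=> ht; have := step n Dn; set S := \sum_(0 <= i < n | D i) a i in ht IH * => an.
have [lt|ge] := ltnP t (L + S).
  by have [s [us /weak sB ss]] := IH t lt; exists s.
have [s [us sB ss]] := IH (t - a n)%N ltac:(lia).
exists (n :: s); split; last by rewrite big_cons ss; lia.
  rewrite /= us andbT; apply/negP => /(allP sB); rewrite ltnn andbF orbF.
  by apply/negP; apply: DB.
by rewrite /= Dn ltnSn orbT /=; apply: weak.
Qed.

Lemma div_mul_bounds n l : (0 < l)%N -> (n - l <= n %/ l * l <= n)%N.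
Proof.
move=> l0; have r := ltn_pmod n l0; rewrite leq_divM andbT {1}(divn_eq n l).
by rewrite leq_subLR addnC leq_add2r ltnW.
Qed.

Section Blocks.
Variables (eps : R) (Heps : Rlt 0 eps /\ Rlt eps 1).
Local Notation fl := (eps_floor eps).
Variable l : nat.
Hypothesis hl : (2 <= eps * INR l)%R.

Lemma block_pos : (0 < l)%N.
Proof. by apply: ltnRE; rewrite /=; have := pos_INR l; nra. Qed.

(** If no pair of positions recurred infinitely often, late blocks would hold at most one element of
    [P] each, a density at most [1 / l], whereas [eps >= 2 / l]. *)
Lemma dense_block_pair (P : pred nat) N :
  (forall n, (N <= n)%N -> (fl n <= count P (iota 0 n))%N) ->
  exists x y, [/\ (x < y)%N, (y < l)%N &
    forall n, exists2 j, (n <= j)%N & P (j * l + x)%N && P (j * l + y)%N].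
Proof.
move=> dens; apply: NNPP => neg; have l0 := block_pos.
have [n0 h0] : exists n0, forall y j, (y < l)%N -> (n0 <= j)%N ->
    forall x, (x < y)%N -> ~~ (P (j * l + x)%N && P (j * l + y)%N).
  apply: eventually_uniform => y yl.
  have [n0 h0] : exists n0, forall x j, (x < y)%N -> (n0 <= j)%N -> ~~ (P (j * l + x)%N && P (j
    * l + y)%N).
    apply: eventually_uniform => x xy; apply: NNPP => h; apply: neg; exists x, y; split => // n.
    apply: NNPP => h2; apply: h; exists n => j nj; apply/negP => Pj; apply: h2; by exists j.
  by exists n0 => j nj x xy; apply: h0.
have one j : (n0 <= j)%N -> (count P (iota (j * l) l) <= 1)%N.
  move=> nj; rewrite -size_filter; set s := filter _ _.
  have us : uniq s by rewrite filter_uniq ?iota_uniq.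
  have hs i : i \in s -> P i /\ (j * l <= i < j * l + l)%N.
    by rewrite mem_filter mem_iota => /andP[].
  case: s us hs => [|u [|v s]] //=; rewrite !inE !negb_or -andbA => /andP[uv _] hs.
  have [Pu hu] := hs u ltac:(by rewrite !inE eqxx).
  have [Pv hv] := hs v ltac:(by rewrite !inE eqxx orbT).
  have eu : u = (j * l + (u - j * l))%N by lia.
  have ev : v = (j * l + (v - j * l))%N by lia.
  have [uv'|vu'|e] := ltngtP u v; last by rewrite e eqxx in uv.
    by have := h0 (v - j * l)%N j ltac:(lia) nj (u - j * l)%N ltac:(lia); rewrite -eu -ev Pu Pv.
  by have := h0 (u - j * l)%N j ltac:(lia) nj (v - j * l)%N ltac:(lia); rewrite -eu -ev Pu Pv.
have cnt k : (count P (iota 0 ((n0 + k) * l)) <= n0 * l + k)%N.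
  elim: k => [|k IH].
    by rewrite !addn0; apply: leq_trans (count_size _ _) _; rewrite size_iota.
  rewrite addnS mulSnr iotaD count_cat add0n.
  by have := one (n0 + k)%N (leq_addr _ _); lia.
have many k : (2 * k <= fl (k * l))%N.
  apply: (eps_floor_geP Heps); rewrite !mult_INR.
  by have := pos_INR k; rewrite [INR 2]/=; nra.
pose k := (N + n0 * l + 1)%N.
have le1 := cnt k; have le2 := many (n0 + k)%N.
have := dens ((n0 + k) * l)%N ltac:(rewrite /k; nia); rewrite /k in le1 le2 *; lia.
Qed.

Variables (b : nat -> nat).
Hypothesis b_mono : forall i j, (i < j)%N -> (b i < b j)%N.
Local Notation M := (l`!).

(* The terms come in blocks of [l], each a progression of difference [M] whose terms are 1
   modulo [M]; the factor [M ^ 2] makes a position within the block determine the residue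
   modulo [d * M] for every [d < l]. *)
Definition block_seq (n : nat) : nat := (1 + M * (n %% l) + M * M * b (n %/ l * l))%N.

(** The position inside a block contributes less than [M * M], as [l <= M]; a later block adds at
    least [M * M]. *)
Lemma block_seq_mono i j : (i < j)%N -> (block_seq i < block_seq j)%N.
Proof.
move=> ij; have l0 := block_pos; have M0 := fact_gt0 l; have lM := fact_geq l.
have ri := ltn_pmod i l0; have rj := ltn_pmod j l0.
have ei := divn_eq i l; have ej := divn_eq j l.
rewrite /block_seq; have := leq_div2r l (ltnW ij); rewrite leq_eqVlt => /orP[/eqP e|lt].
  rewrite -e in ej *; rewrite ltn_add2r ltn_add2l ltn_pmul2l //.
  by lia.
have := b_mono (_ : i %/ l * l < j %/ l * l)%N; rewrite ltn_pmul2r // => /(_ lt) blt.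
have h1 : (M * (i %% l) < M * M)%N by rewrite ltn_pmul2l //; lia.
have h2 : (M * M * (b (i %/ l * l)).+1 <= M * M * b (j %/ l * l))%N by rewrite leq_mul2l blt orbT.
by rewrite mulnS in h2; lia.
Qed.

Lemma block_seq_bounds n : (b (n - l) <= block_seq n <= M * M * (b n + 2))%N.
Proof.
have l0 := block_pos; have M0 := fact_gt0 l; have lM := fact_geq l.
have r := ltn_pmod n l0; have /andP[k1 k2] := div_mul_bounds n l0.
have b_le i j : (i <= j)%N -> (b i <= b j)%N.
  by rewrite leq_eqVlt => /orP[/eqP -> //|/b_mono/ltnW].
have le1 : (b (n - l) <= b (n %/ l * l))%N by apply: b_le.
have le2 : (b (n %/ l * l) <= b n)%N by apply: b_le.
have h1 : (M * (n %% l) < M * M)%N by rewrite ltn_pmul2l //; lia.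
have h2 : (M * M * b (n %/ l * l) <= M * M * b n)%N by rewrite leq_mul2l le2 orbT.
have h3 : (b (n %/ l * l) <= M * M * b (n %/ l * l))%N by rewrite leq_pmull // muln_gt0 M0.
by rewrite /block_seq mulnDr; lia.
Qed.

Lemma block_seq_slack : slack_sums eps b -> slack_sums eps block_seq.
Proof.
move=> sb T; have l0 := block_pos; have M0 := fact_gt0 l.
(* Of the extra [l + 1] terms, [l] allow for the shift to the block start and one, at least 2, pays
   for the 2 in [block_seq_bounds]. *)
have [N1 h1] := sb (T + l + 1)%N; have [N2 h2] := eps_floor_unbounded Heps (T + l + 3)%N.
exists (N1 + N2)%N => n hn; have hb := h1 n ltac:(lia); have hf := h2 n ltac:(lia).
have /andP[_ up] := block_seq_bounds n; apply: leq_trans up _.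
set y := (fl n - (T + l + 1))%N in hb.
have y2 : (2 <= b y)%N.
  have b_ge i : (i <= b i)%N by elim: i => // i IH; have := b_mono (ltnSn i); lia.
  by apply: leq_trans (b_ge y); rewrite /y; lia.
have -> : (fl n - T = y.+1 + l)%N by rewrite /y; lia.
rewrite (big_cat_nat (n := l)) ?leq_addl //=; apply: leq_trans (leq_addl _ _).
rewrite -[X in \sum_(X <= _ < _) _]add0n big_addn addnK.
apply: leq_trans (_ : M * M * \sum_(0 <= i < y.+1) b i <= _)%N.
  by rewrite leq_mul2l big_nat_recr //= leq_add // orbT.
rewrite big_distrr /=; apply: leq_sum => i _; rewrite /block_seq.
apply: leq_trans (leq_addl _ _); rewrite leq_mul2l; apply/orP; right.
have /andP[] := div_mul_bounds (i + l) l0; rewrite addnK => + _.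
by rewrite leq_eqVlt => /orP[/eqP <- //|/b_mono/ltnW].
Qed.

Lemma block_seq_at j x : (x < l)%N ->
  block_seq (j * l + x) = (1 + M * x + M * M * b (j * l))%N.
Proof.
by move=> xl;
  rewrite /block_seq modnMDl modn_small // divnMDl ?(leq_ltn_trans _ xl) // divn_small // addn0.
Qed.

End Blocks.

(* [js1] supplies all residues modulo [q]; switching between the two members of a pair from
   [js2] moves a sum by exactly [q]. *)
Lemma interval_of_pairs (a lo hi : nat -> nat) q r (js1 js2 : seq nat) t :
  (0 < q)%N -> (0 < r)%N -> coprime r q -> injective lo -> injective hi ->
  (forall i j, lo i != hi j) ->
  (forall j, a (lo j) = r %[mod q]) -> (forall j, a (hi j) = (a (lo j) + q)%N) ->
  uniq (js1 ++ js2) -> size js1 = q ->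
  (\sum_(j <- js1) a (lo j) + t <= size js2)%N ->
  exists s, [/\ uniq s, {subset s <= map lo js1 ++ map lo js2 ++ map hi js2} &
    \sum_(i <- s) a i = (\sum_(j <- js1) a (lo j) + \sum_(j <- js2) a (lo j) + t)%N].
Proof.
move=> q0 r0 cop ilo ihi lohi alo ahi ujs s1 s2.
set X1 := \sum_(j <- js1) a (lo j) in s2 *.
have [u uq ur] := residue_multiple (X1 + t) q0 r0 cop.
pose Cu := \sum_(j <- take u js1) a (lo j).
have CuX : (Cu <= X1)%N by rewrite /X1 -(cat_take_drop u js1) big_cat leq_addr.
have Cur : Cu = u * r %[mod q].
  have gen s : \sum_(j <- s) a (lo j) = size s * r %[mod q].
    elim: s => [|j s IH]; first by rewrite big_nil.
    by rewrite big_cons /= mulSn -modnDm alo IH modnDm.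
  by rewrite /Cu gen size_takel // s1 ltnW.
(* [Cu] has the residue of [X1 + t]; the quotient [k] is the number of pairs to switch upward. *)
have /dvdnP[k hk] : (q %| X1 + t - Cu)%N.
  by rewrite -eqn_mod_dvd; [rewrite -ur Cur | lia].
have ks : (k <= size js2)%N by nia.
move: ujs; rewrite cat_uniq -(cat_take_drop k js2) cat_uniq =>
  /and3P[u1 /hasPn dis /and3P[u2 /hasPn dis2 u3]].
exists (map lo (take u js1) ++ map hi (take k js2) ++ map lo (drop k js2)); split.
- rewrite cat_uniq; apply/and3P; split; first by rewrite map_inj_uniq ?take_uniq.
    apply/hasPn => i; rewrite mem_cat => /orP[] /mapP[j hj ->]; apply/negP => /mapP[j' hj'].
      by move=> e; have := lohi j' j; rewrite e eqxx.
    move/ilo => e; have := dis j; rewrite mem_cat hj orbT => /(_ isT).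
    by rewrite /= e (mem_take hj').
  rewrite cat_uniq; apply/and3P; split; try by rewrite map_inj_uniq.
  apply/hasPn => i /mapP[j hj ->]; apply/negP => /mapP[j' _ e].
  by have := lohi j j'; rewrite e eqxx.
- move=> i; rewrite !mem_cat => /or3P[] /mapP[j hj ->].
  + by rewrite map_f // (mem_take hj).
  + by rewrite (map_f hi) ?orbT // mem_cat hj.
  + by rewrite (map_f lo (s := _ ++ _)) ?orbT // mem_cat hj orbT.
rewrite !big_cat !big_map /= -/Cu.
rewrite (eq_bigr (fun j => a (lo j) + q)%N) // big_split /= big_const_seq count_predT.
by rewrite iter_addn_0 size_takel //; lia.
Qed.

(** * Completeness of dense subsequences of the block sequence *)

Section Sufficiency.
Variables (eps : R) (Heps : Rlt 0 eps /\ Rlt eps 1).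
Local Notation fl := (eps_floor eps).
Variable l : nat.
Hypothesis hl : (2 <= eps * INR l)%R.
Variables (b : nat -> nat).
Hypothesis b_mono : forall i j, (i < j)%N -> (b i < b j)%N.
Hypothesis b_slack : slack_sums eps b.
Local Notation a := (block_seq l b).

Lemma block_seq0_gt0 : (0 < a 0)%N.
Proof. by rewrite /block_seq. Qed.

(* The sizes are chosen in the order [q], [n1], [L], [K], [n2]: the pairs lie beyond index [n2],
   so removing them does not disturb the sums below, and above [n2] the slack absorbs the
   [q + 2 * K] removed terms. *)
Lemma dense_image_complete (P : pred nat) N :
  (forall n, (N <= n)%N -> (fl n <= count P (iota 0 n))%N) ->
  complete (image_set a P).
Proof.
move=> dens; have l0 := block_pos Heps hl; have M0 := fact_gt0 l.
have a_mono := block_seq_mono Heps hl b_mono; have a0 := block_seq0_gt0.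
have [x [y [xy yl inf]]] := dense_block_pair Heps hl dens.
pose lo j := (j * l + x)%N; pose hi j := (j * l + y)%N.
pose q := ((y - x) * l`!)%N; pose r := (1 + l`! * x)%N.
(* As [y - x] divides the factorial and [r] is 1 modulo it, [r] is prime to both factors of [q]. *)
have dM : (y - x %| l`!)%N by apply: dvdn_fact; lia.
have q0 : (0 < q)%N by rewrite muln_gt0 M0 andbT; lia.
have cop : coprime r q.
  have c1 : coprime r l`! by rewrite coprime_sym /coprime /r addnC mulnC gcdnMDl gcdn1.
  by rewrite coprimeMr c1 andbT; apply: coprime_dvdr c1.
have loE j : a (lo j) = (r + l`! * l`! * b (j * l))%N by rewrite block_seq_at //; lia.
have hiE j : a (hi j) = (a (lo j) + q)%N.
  by rewrite loE block_seq_at // /r /q mulnBl [(l`! * y)%N]mulnC [(l`! * x)%N]mulnC;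
    have : (x * l`! <= y * l`!)%N; [rewrite leq_mul2r; lia | lia].
have lor j : a (lo j) = r %[mod q].
  have [c hc] := dvdnP dM; rewrite loE.
  have -> : (l`! * l`! * b (j * l) = (c * b (j * l)) * q)%N by rewrite /q {1}hc; lia.
  by rewrite addnC modnMDl.
have ilo : injective lo by move=> i j /addIn /eqP; rewrite eqn_pmul2r // => /eqP.
have ihi : injective hi by move=> i j /addIn /eqP; rewrite eqn_pmul2r // => /eqP.
have lohi i j : lo i != hi j.
  apply/eqP => /(congr1 (modn^~ l)); rewrite /lo /hi !modnMDl !modn_small //; lia.
pose J j := P (lo j) && P (hi j).
have sel := @infinite_select J inf.
have [js1 [sz1 u1 /allP J1]] := sel q 0.
pose X1 := \sum_(j <- js1) a (lo j).
have [n1 h1] := block_seq_slack Heps hl b_mono b_slack q.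
(* [L] dominates the terms of index up to [n1']; [K] pairs are enough to reach [X1 + t] for every
   [t < L]. *)
pose n1' := (n1 + N)%N; pose L := a n1'; pose K := (X1 + L)%N.
have [n2 h2] := block_seq_slack Heps hl b_mono b_slack (q + 2 * K).
pose n2' := (n2 + N)%N.
(* The added sum puts the new pairs beyond all of [js1]. *)
have [js2 [sz2 u2 /allP J2]] := sel K (n2' + (\sum_(j <- js1) j).+1)%N.
have js1_lt j : j \in js1 -> (j < (\sum_(j <- js1) j).+1)%N.
  by move=> hj; rewrite ltnS (big_rem j) //= leq_addr.
have ujs : uniq (js1 ++ js2).
  by rewrite cat_uniq u1 u2 andbT /=; apply/hasPn => j /J2 h; apply/negP => /js1_lt; lia.
pose B := map lo js1 ++ map lo js2 ++ map hi js2.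
pose X := (X1 + \sum_(j <- js2) a (lo j))%N.
have BP i : i \in B -> P i.
  by rewrite !mem_cat => /or3P[] /mapP[j hj ->];
    [have := J1 j hj | have := J2 j hj | have := J2 j hj]; rewrite /J => /and3P[].
have sizeB : size B = (q + 2 * K)%N by rewrite !size_cat !size_map sz1 sz2; lia.
pose D i := P i && (i \notin B).
have cntB n : (count (fun i => i < n)%N B <= if (n < n2')%N then q else q + 2 * K)%N.
  case: ifP => nn2; last by rewrite -sizeB; apply: count_size.
  rewrite !count_cat; rewrite -[leqRHS]addn0; apply: leq_add.
    by rewrite -sz1 -(size_map lo); apply: count_size.
  have count0 h : (forall j, j <= h j)%N -> count (fun i => i < n)%N (map h js2) = 0.
    move=> hj; apply/eqP; rewrite eqn0Ngt -has_count; apply/hasPn => i /mapP[j /J2 Jj ->].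
    by have := hj j; lia.
  have jl j : (j <= j * l)%N by rewrite leq_pmulr.
  by rewrite !count0 // => j; apply: leq_trans (jl j) (leq_addr _ _).
have cntD n T : (N <= n)%N -> (count (fun i =>
  i < n)%N B <= T)%N -> (fl n - T <= count D (iota 0 n))%N.
  by move=> Nn hT; have := count_remove P B n; have := dens n Nn; rewrite -/D; lia.
have step n : (a n <= L + \sum_(0 <= i < n | D i) a i)%N.
  have [nn1|n1n] := leqP n n1'.
    by apply: leq_trans (leq_addr _ _); rewrite (increasing_leE a_mono a0).
  apply: leq_trans (leq_addl _ _); have := cntB n; case: ifP => nn2 hB.
    apply: leq_trans (h1 n ltac:(lia)) _; apply: (sum_first_le a_mono a0); apply: cntD hB; lia.
  apply: leq_trans (h2 n ltac:(lia)) _; apply: (sum_first_le a_mono a0); apply: cntD hB; lia.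
have base t : (t < L)%N -> exists s, [/\ uniq s, {subset s <= B} & \sum_(i <- s) a i = (X + t)%N].
  move=> tL; apply: (interval_of_pairs (r := r) (q := q)) => //.
  by rewrite sz2 /K leq_add2l ltnW.
exists X => m Xm; apply/(in_Sigma_image_set a_mono a0).
have [n3 h3] := eps_floor_unbounded Heps (q + 2 * K + (m - X).+1).
have DB i : D i -> i \notin B by case/andP.
have mX : (m - X < L + \sum_(0 <= i < n3 + N | D i) a i)%N.
  apply: leq_trans (leq_addl _ _).
  apply: (@leq_trans (count D (iota 0 (n3 + N)))).
    apply: leq_trans (cntD _ (q + 2 * K)%N _ _); [|lia|by rewrite -sizeB; apply: count_size].
    by have := h3 (n3 + N)%N ltac:(lia); lia.
  rewrite -sum1_count /index_iota subn0; apply: leq_sum => i _.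
  by have := increasing_gt a_mono a0 i; lia.
have [s [us sB ss]] := cascade DB base (fun n _ => step n) mX.
exists s; split => //; last by rewrite ss; lia.
by apply: sub_all sB => i /orP[/BP //|/andP[/andP[]]].
Qed.

Lemma block_set_eps_complete : eps_complete eps (image_set a predT).
Proof.
have a_mono := block_seq_mono Heps hl b_mono; have a0 := block_seq0_gt0.
move=> A' sub [N hN]; pose P i := A' (a i).
have A'E : A' =1 image_set a P.
  move=> x; apply/idP/(image_setP a_mono a0) => [Ax|[i Pi <-]] //.
  by have /(image_setP a_mono a0)[i _ e] := sub x Ax; exists i; rewrite /P ?e.
have [N' hN'] : complete (image_set a P).
  (* The value [a n] closes the first [n + 1] indices, so the density is tested there. *)
  apply: (@dense_image_complete P N.+1) => -[//|n] Nn; apply: leqRE.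
  have := hN (a n); rewrite (count_image_set_at a_mono a0) count_predT size_iota.
  have -> : count_upto A' (a n) = count P (iota 0 n.+1).
    by rewrite -(count_image_set_at a_mono a0) /count_upto (eq_count A'E).
  have := increasing_gt a_mono a0 n => na /(_ ltac:(lia)).
  by have [h _] := eps_floorP Heps n.+1; apply: Rle_trans.
exists N' => m /hN'[s [us sA ss]]; exists s; split => //.
by rewrite (eq_all A'E).
Qed.

End Sufficiency.

(** * Both bounds, with the order of magnitude of the block sequence *)

Theorem theorem1p3 (eps : R) (Heps : Rlt 0 eps /\ Rlt eps 1) (f : nat -> nat)
  (Hfpos : forall n : nat, (1 <= n)%N -> (0 < f n)%N)
  (Hrec : exists N : nat, forall n : nat, (N <= n)%N -> eps_recurrence eps f n) :
  (forall A : pred nat, ~~ A 0 -> eps_complete eps A -> bigO_terms A f) /\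
  (exists A : pred nat, ~~ A 0 /\ eps_complete eps A /\ Theta_terms A f).
Proof.
have [N0 f_rec] : exists N0, forall n, (N0 <= n)%N ->
    f n = \sum_(1 <= i < (eps_floor eps n).+1) f i.
  by case: Hrec => N h; exists N => n /h; apply: eps_recurrenceE.
split=> [A|]; first by apply: (eps_complete_bigO Heps Hfpos); exists N0.
have [b [b_mono b_slack [C [N hb]]]] := slack_majorant Heps Hfpos f_rec.
have [l hl'] := nat_above (2 / eps).
have hl : (2 <= eps * INR l)%R.
  have -> : 2%R = (eps * (2 / eps))%R by field; lra.
  by apply: Rmult_le_compat_l; lra.
have a_mono := block_seq_mono Heps hl b_mono; have a0 := block_seq0_gt0 l b.
exists (image_set (block_seq l b) predT); split.
  by apply/negP => /(image_setP a_mono a0)[i _]; have := increasing_gt a_mono a0 i; lia.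
split; first exact: block_set_eps_complete.
have [N1 hN1] := eps_floor_unbounded Heps N0.
(* Doubling offsets the index lag of up to [l] in [block_seq_bounds]. *)
have back k n : (N0 + N1 <= n)%N -> (f (n + k) <= 2 ^ k * f n)%N.
  move=> hn; elim: k => [|k IH]; first by rewrite addn0 mul1n.
  have := @rec_double _ Heps _ _ f_rec (n + k)%N ltac:(lia) (hN1 (n + k).+1 ltac:(lia)).
  by rewrite addnS expnS -mulnA; lia.
(* [c] covers the [l + 1] doublings from [n - 1 - l] to [n]; in [D] the additive 2 becomes a factor
   because [f n >= 1]. *)
pose c := (2 ^ l.+1)%N; pose D := (l`! * l`! * (C + 2))%N.
have c0 : (0 < INR c)%R by apply/(lt_INR 0)/ltP; rewrite expn_gt0.
exists (/ INR c)%R, (INR D), (N0 + N1 + N + l + 2)%N; split; first exact: Rinv_0_lt_compat.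
have M0 := fact_gt0 l; split; first by apply/(lt_INR 0)/ltP; rewrite !muln_gt0 M0 addn_gt0 orbT.
move=> n m hn /(nth_term_image a_mono a0)[n0 ->].
have /andP[lb ub] := block_seq_bounds Heps hl b_mono n.-1.
have /andP[lb2 _] := hb (n.-1 - l)%N ltac:(lia); have /andP[_ ub2] := hb n.-1 ltac:(lia).
split.
  have := back l.+1 (n.-1 - l)%N ltac:(lia); have -> : (n.-1 - l + l.+1 = n)%N by lia.
  move=> h; have /leqR : (f n <= c * block_seq l b n.-1)%N.
    by apply: leq_trans h _; rewrite leq_mul2l (leq_trans lb2 lb) orbT.
  rewrite mult_INR => h2; apply: (Rmult_le_reg_l (INR c)) => //.
  by rewrite -Rmult_assoc Rinv_r ?Rmult_1_l //; lra.
have fm : (f n.-1 <= f n)%N by apply: (rec_mono Heps f_rec); lia.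
suff /leqR : (block_seq l b n.-1 <= D * f n)%N by rewrite mult_INR.
apply: leq_trans ub _; rewrite /D -(mulnA (l`! * l`!)) leq_mul2l; apply/orP; right.
by have := Hfpos n ltac:(lia); nia.
Qed.
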